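(* Let $\Gamma$ be a finite connected 3-regular graph with orientation. Then any automorphism $\phi$ of $\Gamma$ (as a graph with orientation) induces an automorphism of the Riemann surface $S^O(\Gamma)$; that is, there is an automorphism $\Phi$ of $S^O(\Gamma)$ mapping, for each vertex $v$ of $\Gamma$, the triangle of $S^O(\Gamma)$ at $v$ onto the triangle at $\phi(v)$, and the side of the triangle at $v$ corresponding to an edge-end at $v$ onto the side of the triangle at $\phi(v)$ corresponding to the image of that edge-end under $\phi$.
   Context: Graphs may have loops and multiple edges. A 3-regular graph is a graph with three edges incident at each vertex (loops counted twice). An orientation at a vertex is a cyclic ordering of the three edge-ends at that vertex; a graph with orientation is a graph with a choice of orientation at every vertex. An automorphism of a graph with orientation is a graph automorphism (acting on vertices, edges and edge-ends) which is orientation-preserving: it carries the cyclic ordering at each vertex $v$ to the cyclic ordering at $\phi(v)$. Construction of $S^O(\Gamma)$. Let $\mathbb{D}$ be the unit disk with the hyperbolic metric and $\omega=e^{2\pi i/3}$. The standard marked ideal triangle is the ideal triangle in $\mathbb{D}$ with vertices $1,\omega,\omega^2$ together with one marked point (tick-mark) on each side, the tick-marks being $t_1=-(2-\sqrt3)$, $t_2=-(2-\sqrt3)\omega$, $t_3=-(2-\sqrt3)\omega^2$. Place one copy of the standard marked ideal triangle at each vertex $v$ of $\Gamma$ so that the three edge-ends at $v$, in their cyclic order, correspond to the geodesic segments from $0$ to $t_1,t_2,t_3$ respectively (hence to the three sides of the triangle in counterclockwise order). For each edge of $\Gamma$, glue the two triangle sides corresponding to its two ends by the isometry which matches the tick-marks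 and is such that the orientations of the triangles match up. The result is a complete hyperbolic Riemann surface of finite area, denoted $S^O(\Gamma)$. *)

(* Defs.v *)
From HB Require Import structures.
From Stdlib Require Import Relation_Operators.
From mathcomp Require Import all_boot all_order all_fingroup all_algebra.
From mathcomp Require Import generic_quotient.
From mathcomp Require Import all_classical all_reals all_analysis.
From mathcomp Require Import complex ring lra.

Set Implicit Arguments.
Unset Strict Implicit.
Unset Printing Implicit Defensive.
Import Order.TTheory GRing.Theory Num.Theory.
Import numFieldNormedType.Exports.
Local Open Scope classical_set_scope.
Local Open Scope ring_scope.

(* The complex plane over R : realType, as a normed space over R[i]: on it
   derivable is complex differentiability. *)
Notation plane R := (R[i]^o).

(* An edge has exactly two ends, possibly at the same vertex: loops and
   multiple edges are allowed, and a loop counts twice in the valence. *)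
Record graph := Graph {
  vertex : finType;
  edge : finType;
  edge_end : finType;
  end_vertex : edge_end -> vertex;
  end_edge : edge_end -> edge;
  two_ends : forall e, #|[pred h | end_edge h == e]| = 2%N }.

Definition three_regular (G : graph) :=
  forall v : vertex G, #|[pred h : edge_end G | end_vertex h == v]| = 3%N.

Definition adjacent (G : graph) : rel (vertex G) := fun v w =>
  [exists h : edge_end G, exists k : edge_end G,
    [&& h != k, end_edge h == end_edge k, end_vertex h == v
      & end_vertex k == w]].

Definition connected_graph (G : graph) :=
  (0 < #|vertex G|)%N /\ forall v w : vertex G, connect (@adjacent G) v w.

(* The cyclic orderings at all the vertices are given together, as one
   permutation sending each edge-end to the next one at the same vertex. *)
Record orientation (G : graph) := Orientation {
  next_end :> {perm edge_end G};
  next_endP : forall h k : edge_end G,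
    (k \in porbit next_end h) = (end_vertex k == end_vertex h) }.

Record graph_automorphism (G : graph) := GraphAutomorphism {
  aut_vertex : {perm vertex G};
  aut_edge : {perm edge G};
  aut_end : {perm edge_end G};
  aut_end_vertex : forall h,
    end_vertex (aut_end h) = aut_vertex (end_vertex h);
  aut_end_edge : forall h, end_edge (aut_end h) = aut_edge (end_edge h) }.

Definition orientation_preserving (G : graph) (o : orientation G)
    (phi : graph_automorphism G) :=
  forall h, aut_end phi (o h) = o (aut_end phi h).

(* Which of t_1, t_2, t_3 (numbered 0, 1, 2) each edge-end corresponds to. *)
Record placement (G : graph) (o : orientation G) := Placement {
  place :> edge_end G -> 'I_3;
  placeP : forall h, place (o h) = ordS (place h) }.

Lemma placement_exists (G : graph) (o : orientation G) :
  three_regular G -> inhabited (placement o).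
Proof.
move=> reg.
have base (v : vertex G) : {b : edge_end G | end_vertex b == v}.
  by apply/sigW/existsP; rewrite -[[exists _, _]]negbK; apply/existsPn => nb;
     have := reg v; rewrite eq_card0 // => h; rewrite !inE; apply/negbTE/nb.
pose b (h : edge_end G) := sval (base (end_vertex h)).
have bP h : end_vertex (b h) = end_vertex h by apply/eqP/(svalP (base _)).
have hb h : h \in porbit o (b h) by rewrite next_endP bP.
have c3 h : #|porbit o h| = 3%N.
  by rewrite -(reg (end_vertex h)); apply: fintype.eq_card => k; rewrite next_endP inE.
have oE h : end_vertex (o h) = end_vertex h.
  by apply/eqP; rewrite -(next_endP o); have := mem_porbit o 1 h; rewrite expg1.
have bo h : b (o h) = b h by rewrite /b oE.
pose f h := index h (traject o (b h) 3).
have f3 h : (f h < 3)%N.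
  have <- : size (traject o (b h) 3) = 3%N by rewrite size_traject.
  by rewrite index_mem -(c3 (b h)) -porbit_traject.
have fE h : iter (f h) o (b h) = h.
  have m : h \in traject o (b h) 3 by rewrite -index_mem size_traject f3.
  by rewrite -(nth_traject o (f3 h)) nth_index.
have u h : uniq (traject o (b h) 3) by rewrite -(c3 (b h)) uniq_traject_porbit.
exists; exists (fun h => Ordinal (f3 h)) => h; apply: val_inj => /=.
rewrite {1}/f bo -{1}(fE h) -iterS.
move: (f3 h); rewrite leq_eqVlt => /predU1P[e|lt].
  have -> : f h = 2%N by case: e.
  have -> : iter 3 o (b h) = b h by rewrite -[3%N](c3 (b h)) iter_porbit.
  by rewrite /= eqxx.
by rewrite modn_small // -(nth_traject o lt) index_uniq // size_traject.
Qed.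

Section RiemannSurfaces.
Variable R : realType.

(* A chart is presented by its inverse, a parametrization of an open subset of
   the space by an open subset of the plane; outside chart_dom the value of
   chart_param is irrelevant. *)
Record chart (X : Type) := Chart {
  chart_dom : set (plane R);
  chart_param : plane R -> X }.

Definition chart_coord (X : Type) (c : chart X) : X -> plane R :=
  'pinv_(fun=> 0) (chart_dom c) (chart_param c).

Definition holomorphic_map (X Y : topologicalType) (A : set (chart X))
    (B : set (chart Y)) (f : X -> Y) :=
  continuous f /\
  forall c d, A c -> B d -> forall z, chart_dom c z ->
    (chart_param d @` chart_dom d) (f (chart_param c z)) ->
    derivable (chart_coord d \o f \o chart_param c : plane R -> plane R) z 1.

Definition riemann_surface_automorphism (X : topologicalType)
    (A : set (chart X)) (f : X -> X) :=
  exists g : X -> X, [/\ cancel f g, cancel g f,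
    holomorphic_map A A f & holomorphic_map A A g].

End RiemannSurfaces.

Section MarkedIdealTriangle.
Variable R : realType.
Local Notation C := (plane R).

Definition omega : C :=
  ((cos (2 * pi / 3) : R) +i* (sin (2 * pi / 3) : R))%C.

(* The geodesic of the unit disk with ideal endpoints omega and omega^2 is an
   arc of the circle with centre -2 and radius sqrt 3, which is orthogonal to
   the unit circle at these points; the other sides are obtained by rotation. *)
Definition side (i : 'I_3) : set C :=
  [set z | `|z| < 1 /\ `|z + 2 * omega ^+ i| = sqrtC 3].

Definition triangle : set C :=
  [set z | `|z| < 1 /\ forall i : 'I_3, sqrtC 3 <= `|z + 2 * omega ^+ i|].

Definition tick (i : 'I_3) : C := - (2 - sqrtC 3) * omega ^+ i.

Definition arcosh (x : R) : R := ln (x + Num.sqrt (x ^+ 2 - 1)).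

(* The distance for the metric 4 |dz|^2 / (1 - |z|^2)^2. *)
Definition hyperbolic_dist (z w : C) : R :=
  arcosh (1 + complex.Re (2 * `|z - w| ^+ 2 /
                          ((1 - `|z| ^+ 2) * (1 - `|w| ^+ 2)))).

(* A coordinate along side i, decreasing when the boundary of the triangle is
   traversed counterclockwise. *)
Definition side_height (i : 'I_3) (z : C) : R := complex.Im (z / omega ^+ i).

(* The orientations of two triangles glued along a side match up exactly when
   the gluing map reverses the directions induced on the side by them. *)
Definition side_gluing (i j : 'I_3) (s : C -> C) :=
  [/\ set_bij (side i) (side j) s,
      forall z w, side i z -> side i w ->
        hyperbolic_dist (s z) (s w) = hyperbolic_dist z w,
      s (tick i) = tick j &
      forall z w, side i z -> side i w -> side_height i z < side_height i w ->
        side_height j (s w) < side_height j (s z)].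

(* The half-turn of the disk about tick 0: it preserves side 0, exchanging its
   two ends, and exchanges the two triangles adjacent along it. *)
Definition half_turn (z : C) : C := - (2 * z + 1) / (z + 2).

(* The part of the triangle nearer to side 0 than to the two other sides.  The
   charts around the sides are restricted to such parts in order to be
   injective also when the edge is a loop. *)
Definition cell : set C :=
  [set z | triangle z /\
    forall i : 'I_3, i != ord0 -> `|z + 2| < `|z + 2 * omega ^+ i|].

Lemma norm_omega : `|omega| = 1.
Proof. by rewrite normc_def /= cos2Dsin2 sqrtr1. Qed.

Lemma triangle0 : 0 \in triangle.
Proof.
rewrite inE; split=> [|i]; first by rewrite normr0 ltr01.
rewrite add0r normrM normrX norm_omega expr1n mulr1 normr_nat.
rewrite -(@ler_pXn2r _ 2) ?nnegrE ?sqrtC_ge0 ?ler0n// sqrtCK.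
by rewrite -natrX ler_nat.
Qed.

End MarkedIdealTriangle.

Section GluingMaps.
Variable R : realType.
Local Notation C := (plane R).
Local Notation om := (omega R).

Lemma normXom (i : nat) : `|om ^+ i| = 1.
Proof. by rewrite normrX norm_omega expr1n. Qed.
Lemma omX_neq0 (i : nat) : om ^+ i != 0.
Proof. by rewrite -normr_gt0 normXom. Qed.

Lemma norm_rot i (z : C) : `|om ^+ i * z| = `|z|.
Proof. by rewrite normrM normXom mul1r. Qed.

Lemma sideE (i : 'I_3) (u : C) :
  side i (om ^+ i * u) <-> `|u| < 1 /\ `|u + 2| = sqrtC 3.
Proof.
by rewrite /side /= norm_rot [2 * _]mulrC -mulrDr norm_rot.
Qed.

Lemma hyp_rot i (z w : C) :
  hyperbolic_dist (om ^+ i * z) (om ^+ i * w) = hyperbolic_dist z w.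
Proof. by rewrite /hyperbolic_dist -mulrBr !norm_rot. Qed.

Lemma hyp_conj (z w : C) :
  hyperbolic_dist (z^*)%C (w^*)%C = hyperbolic_dist z w.
Proof.
have nJ (u : C) : `|(u^*)%C : C| = `|u| := normcJ u.
have -> : hyperbolic_dist (z^*)%C (w^*)%C = arcosh (1 + complex.Re (2 * `|((z - w)^*)%C : C| ^+ 2 /
      ((1 - `|(z^*)%C : C| ^+ 2) * (1 - `|(w^*)%C : C| ^+ 2)))).
  by rewrite /hyperbolic_dist rmorphB.
by rewrite !nJ.
Qed.

Lemma arcosh_lt (x y : R) : 1 <= x -> x < y -> arcosh x < arcosh y.
Proof.
move=> x1 xy; rewrite /arcosh ltr_ln ?posrE; last 2 first.
- by rewrite ltr_wpDr ?sqrtr_ge0// (lt_le_trans _ x1).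
- by rewrite ltr_wpDr ?sqrtr_ge0//; lra.
by rewrite ltr_leD// ler_wsqrtr//; nra.
Qed.

Lemma arcosh_inj (x y : R) : 1 <= x -> 1 <= y -> arcosh x = arcosh y -> x = y.
Proof.
move=> x1 y1 e; case: (ltgtP x y) => // /arcosh_lt h.
- by have := h x1; rewrite e ltxx.
- by have := h y1; rewrite e ltxx.
Qed.

Lemma omE : om = ((- (1/2) : R) +i* (Num.sqrt 3 / 2 : R))%C.
Proof.
rewrite /omega.
have p0 := pi_gt0 R.
set c := cos (2 * pi / 3); set s := sin (2 * pi / 3).
have cs : c ^+ 2 + s ^+ 2 = 1 by exact: cos2Dsin2.
have s0 : 0 < s by apply: sin_gt0_pi; lra.
have : sin (2 * pi / 3 + (2 * pi / 3 + 2 * pi / 3)) = 0 :> R.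
  have -> : (2 * pi / 3 + (2 * pi / 3 + 2 * pi / 3)) = 0 + pi *+ 2 :> R.
    by rewrite mulr2n; field.
  by rewrite sinD2pi sin0.
rewrite !(sinD, cosD) -/c -/s => e.
have c2 : c ^+ 2 = 1 / 4.
  have : s * (3 * c ^+2 - s^+2) = 0 by rewrite -e; ring.
  move/eqP; rewrite mulf_eq0 (gt_eqF s0) /= => /eqP; lra.
have s2 : s ^+ 2 = 3 / 4 by lra.
have c0 : c < 0.
  have s6 : 0 < sin (pi / 6 : R) by apply: sin_gt0_pi; lra.
  have -> : c = - sin (pi / 6).
    rewrite /c; have -> : 2 * pi / 3 = pi / 6 + pi / 2 :> R by field.
    by rewrite cosDpihalf.
  lra.
have -> : c = - (1/2) by nra.
have -> // : s = Num.sqrt 3 / 2.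
apply/eqP; rewrite -(@eqrXn2 _ 2) ?divr_ge0 ?sqrtr_ge0// ?ltW//.
by rewrite s2 expr_div_n sqr_sqrtr// ; apply/eqP; field.
Qed.

Lemma norm2E (x y : R) : `|(x +i* y)%C : C| ^+ 2 = (x ^+ 2 + y ^+ 2)%:C%C.
Proof.
have -> : `|(x +i* y)%C : C| = `|(x +i* y)%C| by [].
by rewrite normc_def /= -rmorphXn /= sqr_sqrtr ?addr_ge0 ?sqr_ge0.
Qed.

Lemma disk_xy (x y : R) : (`|(x +i* y)%C : C| < 1) = (x ^+ 2 + y ^+ 2 < 1).
Proof.
rewrite -(@ltr_pXn2r _ 2) ?nnegrE ?normr_ge0 ?ler01 // norm2E expr1n.
by rewrite (ltcR _ 1).
Qed.

Lemma circle_xy (x y : R) :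
  (`|(x +i* y)%C + 2 : C| == sqrtC 3) = ((x + 2) ^+ 2 + y ^+ 2 == 3).
Proof.
rewrite -(@eqrXn2 _ 2) ?normr_ge0 ?sqrtC_ge0 ?ler0n// sqrtCK.
have -> : (x +i* y)%C + 2 = ((x + 2) +i* y)%C :> C.
  by apply/eqP; rewrite eq_complex /= !addr0 !eqxx.
by rewrite norm2E -(inj_eq (@complexI R)) rmorph_nat.
Qed.


Lemma hyp_xy (x y x' y' : R) :
  hyperbolic_dist (x +i* y)%C (x' +i* y')%C =
  arcosh (1 + 2 * ((x - x') ^+ 2 + (y - y') ^+ 2) /
    ((1 - (x ^+ 2 + y ^+ 2)) * (1 - (x' ^+ 2 + y' ^+ 2)))).
Proof.
rewrite /hyperbolic_dist.
have -> : (x +i* y)%C - (x' +i* y')%C = ((x - x') +i* (y - y'))%C :> C.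
  by apply/eqP; rewrite eq_complex /= !eqxx.
rewrite !norm2E; congr (arcosh (1 + _)).
have E (a b c : R) : 2 * a%:C%C / ((1 - b%:C%C) * (1 - c%:C%C)) =
   (2 * a / ((1 - b) * (1 - c)))%:C%C.
  by rewrite fmorph_div /= !(rmorphM, rmorphB) /= rmorph1 rmorph_nat.
by rewrite [X in complex.Re X]E.
Qed.

Local Notation tau := (- (2 - Num.sqrt 3) : R).

Lemma sqrtC3 : sqrtC 3 = (Num.sqrt 3 : R)%:C%C :> C.
Proof.
apply/eqP; rewrite -(@eqrXn2 _ 2) ?sqrtC_ge0 ?ler0n//; last first.
  by rewrite (lecR 0) sqrtr_ge0.
by rewrite sqrtCK -rmorphXn /= sqr_sqrtr// rmorph_nat.
Qed.

Lemma tickE i : tick R i = om ^+ i * (tau +i* 0)%C.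
Proof.
rewrite /tick mulrC sqrtC3; congr (_ * _).
by apply/eqP; rewrite eq_complex /= !(addr0, oppr0, subr0) !eqxx.
Qed.

Definition on0 (x y : R) := x ^+ 2 + y ^+ 2 < 1 /\ (x + 2) ^+ 2 + y ^+ 2 = 3.

Lemma side_xy (i : 'I_3) x y : side i (om ^+ i * (x +i* y)%C) <-> on0 x y.
Proof.
rewrite sideE disk_xy; split=> -[? /eqP e]; split=> //; apply/eqP.
  by rewrite -circle_xy.
by rewrite circle_xy.
Qed.

Lemma rot_surj (i : nat) (z : C) : exists x y : R, z = om ^+ i * (x +i* y)%C.
Proof.
case e : (z / om ^+ i) => [x y]; exists x, y.
by rewrite -e mulrC divfK// omX_neq0.
Qed.

Lemma sqrt3 : 0 <= Num.sqrt 3 :> R /\ Num.sqrt 3 ^+ 2 = 3 :> R.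
Proof. by rewrite sqrtr_ge0 sqr_sqrtr. Qed.

Lemma on0_tau : on0 tau 0.
Proof.
by have [h0 h2] := sqrt3; set r := Num.sqrt 3 in h0 h2 *; split; nra.
Qed.

Lemma height_xy (i : 'I_3) x y : side_height i (om ^+ i * (x +i* y)%C) = y.
Proof. by rewrite /side_height [_ * (x +i* y)%C]mulrC mulfK ?omX_neq0. Qed.

Lemma dist_tick x y x' y' : on0 x y -> on0 x' y' ->
  hyperbolic_dist (x +i* y)%C (tau +i* 0)%C =
  hyperbolic_dist (x' +i* y')%C (tau +i* 0)%C -> x = x'.
Proof.
move=> [d c] [d' c']; rewrite !hyp_xy.
have [t1 t2] := on0_tau; set t := - (2 - _) in t1 t2 *.
have P u v : u ^+ 2 + v ^+ 2 < 1 -> 1 <= 1 + 2 * ((u - t) ^+ 2 + (v - 0) ^+ 2) /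
    ((1 - (u ^+ 2 + v ^+ 2)) * (1 - (t ^+ 2 + 0 ^+ 2))).
  move=> h; rewrite lerDl; apply: divr_ge0; apply: mulr_ge0 => //.
  - by rewrite addr_ge0 ?sqr_ge0.
  - by rewrite subr_ge0 ltW.
  - by rewrite subr_ge0 ltW.
move=> /arcosh_inj -/(_ (P _ _ d) (P _ _ d')) /addrI.
have -> : x ^+ 2 + y ^+ 2 = - 1 - 4 * x by lra.
have -> : x' ^+ 2 + y' ^+ 2 = - 1 - 4 * x' by lra.
have -> : (x - t) ^+ 2 + (y - 0) ^+ 2 = -2 - 4 * x - 4 * t - 2 * x * t by nra.
have -> : (x' - t) ^+ 2 + (y' - 0) ^+ 2 = -2 - 4 * x' - 4 * t - 2 * x' * t by nra.
have -> : t ^+ 2 + 0 ^+ 2 = - 1 - 4 * t by lra.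
have hx : 0 < 2 + 4 * x by lra.
have hx' : 0 < 2 + 4 * x' by lra.
have ht : 0 < 2 + 4 * t by lra.
have n1 : (1 - (-1 - 4 * x)) * (1 - (-1 - 4 * t)) != 0.
  by rewrite mulf_neq0 // gt_eqF//; lra.
have n2 : (1 - (-1 - 4 * x')) * (1 - (-1 - 4 * t)) != 0.
  by rewrite mulf_neq0 // gt_eqF//; lra.
move=> /eqP; rewrite eqr_div// => /eqP e.
have tn : t < 0 by have [h0 h2] := sqrt3; rewrite /t; nra.
have : 24 * (x - x') * t * (2 + 4 * t) = 0.
  move/eqP: e; rewrite -subr_eq0 => /eqP <-; ring.
move/eqP; rewrite !mulf_eq0 (gt_eqF ht) (lt_eqF tn) !orbF pnatr_eq0 /= subr_eq0.
by move/eqP.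
Qed.

(* There is exactly one gluing map from side i to side j: in the position of
   side 0, it is the reflection in the real axis. *)
Lemma side_gluingP (i j : 'I_3) (s : C -> C) : side_gluing i j s <->
  forall z, side i z -> s z = om ^+ j * ((z / om ^+ i)^*)%C.
Proof.
have redu u v : om ^+ i * (u +i* v)%C / om ^+ i = (u +i* v)%C :> C.
  by rewrite [_ * (u +i* v)%C]mulrC mulfK ?omX_neq0.
split=> [[bij iso st rev] z | H].
  have [x [y ->]] := rot_surj i z => sz; rewrite redu /=.
  have si0 : side i (tick R i) by rewrite tickE side_xy; exact: on0_tau.
  have := set_bij_homo bij sz.
  have := iso _ _ sz si0; have := rev _ _ sz si0; have := rev _ _ si0 sz.
  rewrite st !tickE; have [x' [y' ->]] := rot_surj j (s (om ^+ i * (x +i* y)%C)).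
  rewrite !hyp_rot !height_xy side_xy; move/side_xy: sz => o r1 r2 ds o'.
  have xx := dist_tick o' o ds; subst x'.
  suff -> : y' = - y by [].
  have e : (y' - y) * (y' + y) = 0 by case: o o' => _ h [_ h']; lra.
  move/eqP: e; rewrite mulf_eq0 subr_eq0 addr_eq0 => /orP[|/eqP//] /eqP ?; subst y'.
  case: (ltgtP y 0) => [/[dup] /r2 ? ?|/[dup] /r1 ? ?|-> //]; last by rewrite oppr0.
    lra.
  lra.
have Hxy x y : on0 x y -> s (om ^+ i * (x +i* y)%C) = om ^+ j * (x +i* - y)%C.
  by move=> /(side_xy i) /H ->; rewrite redu.
have onN x y : on0 x y -> on0 x (- y) by case=> a b; split; rewrite sqrrN.
split.
- split.
  + move=> z; have [x [y ->]] := rot_surj i z => /side_xy o.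
    by rewrite /= Hxy//; apply/side_xy/onN.
  + move=> z w /set_mem + /set_mem; have [x [y ->]] := rot_surj i z.
    have [x' [y' ->]] := rot_surj i w => /side_xy o /side_xy o'.
    rewrite !Hxy// => /(mulfI (omX_neq0 j))/eqP; rewrite eq_complex /= eqr_opp.
    by move=> /andP[/eqP-> /eqP->].
  + move=> z; have [x [y ->]] := rot_surj j z => /side_xy o.
    exists (om ^+ i * (x +i* - y)%C); first by apply/side_xy/onN.
    by rewrite Hxy ?opprK//; apply: onN.
- move=> z w; have [x [y ->]] := rot_surj i z.
  have [x' [y' ->]] := rot_surj i w => /side_xy o /side_xy o'.
  by rewrite !Hxy// !hyp_rot -hyp_conj /= !opprK.
- by rewrite !tickE Hxy ?oppr0//; exact: on0_tau.
- move=> z w; have [x [y ->]] := rot_surj i z.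
  have [x' [y' ->]] := rot_surj i w => /side_xy o /side_xy o'.
  by rewrite !Hxy// !height_xy ltrN2.
Qed.

Lemma half_turn_side (z : C) : side (@ord0 2) z -> half_turn z = (z^*)%C.
Proof.
have [x [y]] := rot_surj 0 z; rewrite expr0 mul1r => -> h.
have /side_xy [d c] : side (@ord0 2) (om ^+ @ord0 2 * (x +i* y)%C) by rewrite mul1r.
have n0 : (x +i* y)%C + 2 != 0 :> C.
  rewrite -normr_gt0; case: h => _; rewrite expr0 mulr1 => ->.
  by rewrite sqrtC_gt0.
apply: (mulIf n0); rewrite /half_turn divfK//.
apply/eqP; rewrite eq_complex /=; apply/andP; split; apply/eqP; lra.
Qed.

End GluingMaps.

Section OrientationSurface.
Variables (R : realType) (G : graph) (o : orientation G) (p : placement o).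
Local Notation C := (plane R).

Definition triangles : Type := {_ : vertex G & set_type (@triangle R)}.

Definition glue_step (x y : triangles) : Prop :=
  exists h k : edge_end G, exists s : C -> C,
    [/\ h != k, end_edge h = end_edge k, side_gluing (p h) (p k) s,
        (tag x = end_vertex h /\ tag y = end_vertex k) &
        (side (p h) (val (tagged x)) /\ val (tagged y) = s (val (tagged x)))].

Definition glued (x y : triangles) : bool :=
  `[< clos_refl_sym_trans triangles glue_step x y >].

Lemma glued_refl : reflexive glued.
Proof. by move=> x; apply/asboolP/rst_refl. Qed.

Lemma glued_sym : symmetric glued.
Proof. by move=> x y; apply/asboolP/asboolP; apply: rst_sym. Qed.

Lemma glued_trans : transitive glued.
Proof.
by move=> y x z /asboolP xy /asboolP yz; apply/asboolP; apply: rst_trans yz.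
Qed.

Canonical glued_equiv := EquivRel glued glued_refl glued_sym glued_trans.

Definition SO : topologicalType := quotient_topology {eq_quot glued_equiv}%qT.

(* The point of the surface given by the point z of the triangle at v (the
   centre of that triangle if z is not in the triangle). *)
Definition SO_point (v : vertex G) (z : C) : SO :=
  \pi_{eq_quot glued_equiv}%qT
    (existT (fun _ : vertex G => set_type (@triangle R)) v
       (insubd (exist _ 0 (@triangle0 R)) z)).

Definition SO_triangle (v : vertex G) : set SO := SO_point v @` @triangle R.

Definition SO_side (h : edge_end G) : set SO :=
  SO_point (end_vertex h) @` @side R (p h).

Definition vertex_chart (v : vertex G) : chart R SO :=
  Chart [set z | `|z| < 1 /\ forall i : 'I_3, sqrtC 3 < `|z + 2 * omega R ^+ i|]
    (SO_point v).

(* A neighbourhood of the side shared by the ends h and k of an edge: the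
   triangle at the vertex of h is developed with that side as side 0, and the
   triangle at the vertex of k is developed beyond it. *)
Definition edge_chart (h k : edge_end G) : chart R SO :=
  Chart [set z | `|z| < 1 /\ (cell z \/ cell (half_turn z))]
    (fun z => if sqrtC 3 <= `|z + 2| then
        SO_point (end_vertex h) (omega R ^+ p h * z)
      else SO_point (end_vertex k) (omega R ^+ p k * half_turn z)).

Definition SO_atlas : set (chart R SO) :=
  [set c | (exists v, c = vertex_chart v) \/
     exists h k : edge_end G,
       [/\ h != k, end_edge h = end_edge k & c = edge_chart h k]].

End OrientationSurface.

Arguments SO_point R {G o} p v z.
Arguments SO_triangle R {G o} p v.
Arguments SO_side R {G o} p h.
Arguments SO_atlas R {G o} p.

(* Main.v *)
Require Import Defs.
From HB Require Import structures.
From Stdlib Require Import Relation_Operators.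
From mathcomp Require Import all_boot all_order all_fingroup all_algebra.
From mathcomp Require Import generic_quotient.
From mathcomp Require Import all_classical all_reals all_analysis.
From mathcomp Require Import complex ring lra.

(** An orientation-preserving automorphism phi shifts the places of the three
    ends at a vertex v by one and the same amount [twist v]: both places and
    phi commute with the cyclic order.  So the rotation of the triangle at v by
    omega ^ twist v, followed by the passage to the triangle at phi v, carries
    the side of each end h to the side of phi h ([twist_place]).  Gluing maps
    are, in the position of side 0, always complex conjugation, hence these
    rotations respect the gluing and descend to the surface ([induced_map]).
    The same construction for the inverse of phi gives the inverse map.

    Read in charts, the induced map is a rotation or the identity: it takes the
    chart of v to the chart of phi v, and the chart of an edge to that of its
    image ([induced_map_chart]).  Being holomorphic, however, is tested against
    every pair of charts, so what remains is that the atlas is holomorphically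
    compatible ([SO_atlas_compatible]) and that its parametrizations are
    injective ([chart_inj]).  Both rest on knowing exactly which points are
    identified.  A point of a triangle lies on at most one side and an edge has
    only two ends, so a second gluing step can only undo the first one; the
    equivalence relation generated by the gluing is therefore equality or a
    single step ([gluedP]).  As the rotated cells of a triangle
    are disjoint, the chart of an edge can meet only itself, its flipped version
    (with transition map the half-turn) and the charts of the two vertices (with
    a rotation, possibly composed with the half-turn). *)

Set Implicit Arguments.
Unset Strict Implicit.
Unset Printing Implicit Defensive.
Import Order.TTheory GRing.Theory Num.Theory.
Import numFieldNormedType.Exports.
Local Open Scope classical_set_scope.
Local Open Scope ring_scope.

(** * The symmetry of order three and the cells *)

Section Geometry.
Variable R : realType.
Local Notation C := (plane R).
Local Notation om := (omega R).
Local Notation side0 := (@side R ord0).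

Lemma omega_sqr : om ^+ 2 = ((- (1/2)) +i* (- (Num.sqrt 3 / 2)))%C.
Proof.
have [_ s2] := sqrt3 R; rewrite omE expr2; apply/eqP; rewrite eq_complex /=.
by apply/andP; split; apply/eqP; nra.
Qed.

Lemma omega_cube : om ^+ 3 = 1.
Proof.
have [_ s2] := sqrt3 R; rewrite exprS omega_sqr omE.
by apply/eqP; rewrite eq_complex /=; apply/andP; split; apply/eqP; nra.
Qed.

Lemma omegaD (i j : 'I_3) : om ^+ (i + j)%R = om ^+ i * om ^+ j.
Proof. by rewrite -exprD /= -[RHS](expr_mod _ omega_cube). Qed.

Lemma norm_vertex_rot (i j : 'I_3) (z : C) :
  `|om ^+ i * z + 2 * om ^+ (i + j)%R| = `|z + 2 * om ^+ j|.
Proof. by rewrite omegaD mulrCA -mulrDr norm_rot. Qed.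

Lemma triangle_rot (i : 'I_3) (z : C) : triangle z -> triangle (om ^+ i * z).
Proof.
case=> d tz; split; first by rewrite norm_rot.
move=> j; have [k ->] : exists k, j = i + k.
  by exists (j - i); rewrite addrC subrK.
by rewrite norm_vertex_rot.
Qed.

Lemma triangle_rotE (i : 'I_3) (z : C) : triangle (om ^+ i * z) <-> triangle z.
Proof.
split=> [/(triangle_rot (- i))|/triangle_rot//].
by rewrite mulrA -omegaD addNr mul1r.
Qed.

Lemma triangle_rotX n (z : C) : triangle (om ^+ n * z) <-> triangle z.
Proof.
rewrite -(expr_mod _ omega_cube).
exact: (@triangle_rotE (Ordinal (ltn_pmod n (isT : (0 < 3)%N)))).
Qed.

Lemma norm_corner (x y : R) :
  [/\ `|(x +i* y)%C + 2 : C| ^+ 2 = (x ^+ 2 + y ^+ 2 + 4 + 4 * x)%:C%C,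
      `|(x +i* y)%C + 2 * om : C| ^+ 2 =
        (x ^+ 2 + y ^+ 2 + 4 - 2 * x + 2 * Num.sqrt 3 * y)%:C%C &
      `|(x +i* y)%C + 2 * om ^+ 2 : C| ^+ 2 =
        (x ^+ 2 + y ^+ 2 + 4 - 2 * x - 2 * Num.sqrt 3 * y)%:C%C].
Proof.
have [_ s2] := sqrt3 R.
have E a b :
    (x +i* y)%C + 2 * (a +i* b)%C = ((x + 2 * a) +i* (y + 2 * b))%C :> C.
  by apply/eqP; rewrite eq_complex /=; apply/andP; split; apply/eqP; ring.
have E2 : (x +i* y)%C + 2 = ((x + 2) +i* y)%C :> C.
  by apply/eqP; rewrite eq_complex /= !addr0 !eqxx.
rewrite E2 omega_sqr omE !E !norm2E.
by split; congr (_%:C%C); lra.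
Qed.

Lemma ord3E (i : 'I_3) : i != ord0 -> i = 1 :> nat \/ i = 2 :> nat.
Proof. by case: i => [[|[|[|]]]]// ? _; [left|right]. Qed.

(** For x + iy on the circle (x + 2)^2 + y^2 = 3 inside the disk, the two strict
    inequalities together say that |sqrt 3 * y| < - 3x; given the equation of
    the circle, the square of this is (2x + 1)^2 > 0.  The sides thus lie in the
    interior of the union of the two adjacent cells, which makes the domains of
    the edge charts open. *)
Lemma side0_cell (z : C) : side0 z -> cell z.
Proof.
case: z => x y; rewrite -[(_ +i* _)%C]mul1r -[1](expr0 om).
move=> /(side_xy ord0) [d c].
rewrite /= mul1r; have [s0 s2] := sqrt3 R.
have [n0 n1 n2] := norm_corner x y.
have x1 : 0 < (2 * x + 1) ^+ 2 by apply: exprn_gt0; nra.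
have y2 : y ^+ 2 < 3 * x ^+ 2 by nra.
have x0 : x < 0 by have := sqr_ge0 x; have := sqr_ge0 y; lra.
have sy : `|Num.sqrt 3 * y| < - 3 * x.
  rewrite -(@ltr_pXn2r _ 2) ?nnegrE ?normr_ge0//; last lra.
  by rewrite real_normK ?num_real// exprMn s2; nra.
move: sy; rewrite ltr_norml => /andP[sy1 sy2].
have n3 : sqrtC 3 = `|(x +i* y)%C + 2 : C|.
  apply/eqP; rewrite -(@eqrXn2 _ 2) ?sqrtC_ge0 ?ler0n// n0 sqrtCK.
  rewrite -(rmorph_nat (real_complex R)) (inj_eq (@complexI R)); apply/eqP; lra.
have V (i : 'I_3) : i != ord0 ->
    `|(x +i* y)%C + 2 : C| < `|(x +i* y)%C + 2 * om ^+ i : C|.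
  move=> /ord3E i0; rewrite -(@ltr_pXn2r _ 2) ?nnegrE// n0.
  by case: i0 => ->; rewrite ?expr1 ?n1 ?n2 ltcR; lra.
split=> //; split=> [|i]; first by rewrite disk_xy.
by have [->|/V/ltW] := eqVneq i ord0; rewrite n3 // expr0 mulr1.
Qed.

(** Each of two points related by a nontrivial rotation would be strictly
    nearer than the other to the centre -2 of the circle carrying side 0. *)
Lemma cell_rot_inj (i j : 'I_3) (u w : C) : cell u -> cell w ->
  om ^+ i * u = om ^+ j * w -> i = j /\ u = w.
Proof.
move=> [_ Vu] [_ Vw]; have [k ->] : exists k, i = j + k.
  by exists (i - j); rewrite addrC subrK.
rewrite omegaD -mulrA => /(mulfI (omX_neq0 _ _)) e.
have [k0|kn0] := eqVneq k ord0; first by rewrite -e k0 addr0 mul1r.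
have := Vw k kn0; have := Vu (- k); rewrite oppr_eq0 => /(_ kn0).
have -> : `|u + 2 * om ^+ (- k)%R| = `|w + 2|.
  by rewrite -(norm_vertex_rot k) subrr mulr1 e.
have -> : `|w + 2 * om ^+ k| = `|u + 2|.
  by have := norm_vertex_rot k 0 u; rewrite addr0 mulr1 e.
by move=> lt1 /(lt_trans lt1); rewrite ltxx.
Qed.

End Geometry.

(** * The half-turn and the domains of the edge charts *)

Section HalfTurn.
Variable R : realType.
Local Notation C := (plane R).
Local Notation om := (omega R).
Local Notation side0 := (@side R ord0).

Lemma side0E (z : C) : side0 z <-> `|z| < 1 /\ `|z + 2| = sqrtC 3.
Proof. by rewrite /side /= expr0 mulr1. Qed.

Lemma disk_add2 (z : C) : `|z| < 1 -> z + 2 != 0.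
Proof.
move=> z1; apply/eqP => /eqP; rewrite addr_eq0 => /eqP z2.
by move: z1; rewrite z2 normrN normr_nat (ltr_nat _ 2 1).
Qed.

Lemma half_turn_add2 (z : C) : `|z| < 1 -> half_turn z + 2 = 3 / (z + 2).
Proof. by move=> /disk_add2 z2; rewrite /half_turn; field. Qed.

Lemma half_turn_disk (z : C) : `|z| < 1 -> `|half_turn z| < 1.
Proof.
move=> /[dup] z1 /disk_add2 z2; rewrite /half_turn normf_div normrN.
rewrite ltr_pdivrMr ?normr_gt0// mul1r.
case: z z1 {z2} => x y; rewrite disk_xy => xy.
have E2 : (x +i* y)%C + 2 = ((x + 2) +i* y)%C :> C.
  by apply/eqP; rewrite eq_complex /= !addr0 !eqxx.
have E1 : 2 * (x +i* y)%C + 1 = ((2 * x + 1) +i* (2 * y))%C :> C.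
  by apply/eqP; rewrite eq_complex /=; apply/andP; split; apply/eqP; ring.
by rewrite -(@ltr_pXn2r _ 2) ?nnegrE// E1 E2 !norm2E ltcR; lra.
Qed.

Lemma half_turnK (z : C) : `|z| < 1 -> half_turn (half_turn z) = z.
Proof.
move=> z1; apply: (@addIr _ (2 : C)).
rewrite half_turn_add2 ?half_turn_disk// half_turn_add2//.
by rewrite invf_div mulrC divfK.
Qed.

(** The half-turn is the inversion in the circle of side 0, followed by the
    reflection in the real axis; it therefore exchanges the inside and the
    outside of that circle. *)
Lemma norm_half_turn (z : C) : `|z| < 1 -> `|half_turn z + 2| * `|z + 2| = 3.
Proof.
move=> z1; rewrite half_turn_add2// -normrM divfK ?normr_nat//.
exact: disk_add2.
Qed.

Let sqrtC3_gt0 : 0 < sqrtC 3 :> C.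
Proof. by rewrite sqrtC_gt0. Qed.

Lemma half_turn_ltr (z : C) : `|z| < 1 ->
  (sqrtC 3 < `|half_turn z + 2|) = (`|z + 2| < sqrtC 3).
Proof.
move=> z1; have z0 : 0 < `|z + 2| by rewrite normr_gt0 disk_add2.
rewrite -(ltr_pM2r z0) norm_half_turn// -(ltr_pM2l sqrtC3_gt0 `|z + 2|).
by rewrite -expr2 sqrtCK.
Qed.

Lemma half_turn_ler (z : C) : `|z| < 1 ->
  (sqrtC 3 <= `|half_turn z + 2|) = (`|z + 2| <= sqrtC 3).
Proof.
move=> z1; have z0 : 0 < `|z + 2| by rewrite normr_gt0 disk_add2.
rewrite -(ler_pM2r z0) norm_half_turn// -(ler_pM2l sqrtC3_gt0 `|z + 2|).
by rewrite -expr2 sqrtCK.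
Qed.

Lemma half_turn_side0 (z : C) : side0 z -> side0 (half_turn z).
Proof.
rewrite !side0E => -[z1 zs]; split; first exact: half_turn_disk.
apply/eqP; rewrite eq_le half_turn_ler// zs lexx andbT.
by rewrite -half_turn_ler ?half_turn_disk// half_turnK// zs.
Qed.

Lemma half_turn_differentiable (z : C) : `|z| < 1 ->
  differentiable (@half_turn R : C -> C) z.
Proof.
move=> z1; apply/derivable1_diffP; rewrite /half_turn.
apply: (@derivableM _ C (fun z => - (2 * z + 1)) (fun z => (z + 2)^-1)).
  by apply: derivableN; apply: derivableD => //; apply: derivableM.
by apply: derivableV; [exact: disk_add2|exact: derivableD].
Qed.

Lemma half_turn_continuous (z : C) : `|z| < 1 ->
  {for z, continuous (@half_turn R : C -> C)}.
Proof. by move=> /half_turn_differentiable /differentiable_continuous. Qed.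

(** The norm takes its values in the complex numbers, whose order is partial, so
    the openness of strict inequalities is derived from Lipschitz bounds. *)
Lemma near_lt (F H : C -> C) (z : C) :
  (forall u w, F u <= F w + `|u - w|) -> (forall u w, H u <= H w + `|u - w|) ->
  F z < H z -> \forall u \near z, F u < H u.
Proof.
move=> LF LH lt; pose e := (H z - F z) / 2.
have e0 : 0 < e by rewrite divr_gt0 ?subr_gt0.
apply/nbhs_normP; exists e => //= u; rewrite /= => zu.
have Fu : F u < F z + e.
  by apply: (le_lt_trans (LF u z)); rewrite ltrD2l distrC.
have Hu : H z - e < H u.
  by rewrite ltrBlDr; apply: (le_lt_trans (LH z u)); rewrite ltrD2l.
apply: (lt_trans Fu); apply: le_lt_trans Hu.
by rewrite le_eqVlt; apply/orP; left; apply/eqP; rewrite /e; field.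
Qed.

Lemma norm_add_lip (a u w : C) : `|u + a| <= `|w + a| + `|u - w|.
Proof.
have -> : u + a = (w + a) + (u - w) by ring.
exact: ler_normD.
Qed.

Lemma cst_lip (a u w : C) : a <= a + `|u - w|.
Proof. by rewrite lerDl. Qed.

Lemma disk_open (z : C) : `|z| < 1 -> \forall u \near z, `|u| < 1.
Proof.
apply: (@near_lt (fun u => `|u|) (fun=> 1)) => u w; last exact: cst_lip.
by have := norm_add_lip 0 u w; rewrite !addr0.
Qed.

Lemma outside_open (a z : C) : sqrtC 3 < `|z + a| ->
  \forall u \near z, sqrtC 3 < `|u + a|.
Proof.
apply: (@near_lt (fun=> sqrtC 3) (fun u => `|u + a|)); first exact: cst_lip.
exact: norm_add_lip.
Qed.

Definition edge_domain : set C :=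
  [set z | `|z| < 1 /\ (cell z \/ cell (half_turn z))].

Definition near_side (z : C) := forall i : 'I_3, i != ord0 ->
  `|z + 2| < `|z + 2 * om ^+ i|.

Lemma cellE z : cell z <-> [/\ `|z| < 1, sqrtC 3 <= `|z + 2| & near_side z].
Proof.
split=> [[[d t] V]|[d t V]].
  by split=> //; have := t ord0; rewrite expr0 mulr1.
split=> //; split=> // i; have [->|/V/ltW] := eqVneq i ord0.
  by rewrite expr0 mulr1.
exact: le_trans.
Qed.

Lemma near_side_open (z : C) : near_side z -> \forall u \near z, near_side u.
Proof.
move=> V; have W (i : 'I_3) : i != ord0 ->
    \forall u \near z, `|u + 2| < `|u + 2 * om ^+ i|.
  move=> /V.
  apply: (@near_lt (fun u => `|u + 2|) (fun u => `|u + 2 * om ^+ i|)).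
    exact: norm_add_lip.
  exact: norm_add_lip.
have W1 := W 1 isT; have W2 := W (1 + 1) isT.
near=> u => i /ord3E [] ->; first by near: u; exact: W1.
by near: u; exact: W2.
Unshelve. all: by end_near. Qed.

Lemma sqrt3_cases (z : C) :
  [\/ sqrtC 3 < `|z + 2|, `|z + 2| < sqrtC 3 | `|z + 2| = sqrtC 3].
Proof.
have cmp : sqrtC 3 >=< `|z + 2|.
  by apply: real_comparable; rewrite ger0_real// ?normr_ge0// ltW.
by case: (comparable_ltgtP cmp) => ?; [apply: Or31|apply: Or32|apply: Or33].
Qed.

Lemma edge_domain_out z : edge_domain z -> sqrtC 3 <= `|z + 2| -> cell z.
Proof.
move=> [z1 [//|]] /cellE[_]; rewrite half_turn_ler// => le1 _ le2.
by apply: side0_cell; rewrite side0E; split=> //; apply/eqP; rewrite eq_le le1.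
Qed.

Lemma edge_domain_half_turn z : edge_domain z -> edge_domain (half_turn z).
Proof.
move=> [z1 c]; split; first exact: half_turn_disk.
by rewrite half_turnK// or_comm.
Qed.

Lemma edge_domain_in z : edge_domain z -> `|z + 2| <= sqrtC 3 ->
  cell (half_turn z).
Proof.
move=> dz; rewrite -half_turn_ler; last by case: dz.
exact/edge_domain_out/edge_domain_half_turn.
Qed.

Lemma edge_domain_open_outside z : `|z| < 1 -> sqrtC 3 < `|z + 2| ->
  edge_domain z -> \forall u \near z, edge_domain u.
Proof.
move=> z1 z3 dz; have /cellE[_ _ V] := edge_domain_out dz (ltW z3).
near=> u; have u1 : `|u| < 1 by near: u; exact: disk_open.
split=> //; left; apply/cellE; split=> //.
  by apply: ltW; near: u; exact: outside_open.
by near: u; exact: near_side_open.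
Unshelve. all: by end_near. Qed.

(** A cell is not open along side 0, but for z on side 0 the open condition
    [near_side] holds both at z and at half_turn z.  It still does nearby, where
    a point lies in the cell or is taken there by the half-turn according as it
    is outside or inside the circle of side 0. *)
Lemma edge_domain_open z : edge_domain z -> \forall u \near z, edge_domain u.
Proof.
move=> dz; have z1 : `|z| < 1 by case: dz.
have hc := half_turn_continuous z1.
case: (sqrt3_cases z) => z3.
- exact: edge_domain_open_outside.
- have hdz := edge_domain_half_turn dz.
  have : \forall u \near half_turn z, edge_domain u.
    by apply: edge_domain_open_outside => //; [case: hdz|rewrite half_turn_ltr].
  move=> /hc near1; near=> u; have u1 : `|u| < 1 by near: u; exact: disk_open.
  rewrite -[u]half_turnK//; apply: edge_domain_half_turn; near: u; exact: near1.
- have sz : side0 z by rewrite side0E.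
  have /cellE[_ _ V] := side0_cell sz.
  have /cellE[_ _ /near_side_open/hc V'] := side0_cell (half_turn_side0 sz).
  near=> u; have u1 : `|u| < 1 by near: u; exact: disk_open.
  split=> //; case: (sqrt3_cases u) => u3.
  + left; apply/cellE; split=> //; first exact: ltW.
    by near: u; exact: near_side_open.
  + right; apply/cellE; split; [exact: half_turn_disk| |].
      by rewrite half_turn_ler// ltW.
    by near: u; exact: V'.
  + by left; apply: side0_cell; rewrite side0E.
Unshelve. all: by end_near. Qed.

End HalfTurn.

(** * Which points are identified *)

Section EdgeEnds.
Variables (G : graph) (o : orientation G) (p : placement o).

Lemma other_end (h k k' : edge_end G) : h != k -> end_edge h = end_edge k ->
  k != k' -> end_edge k = end_edge k' -> k' = h.
Proof.
move=> hk ehk kk' ekk'; apply/eqP/negP => /negP k'h.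
have : uniq [:: h; k; k'] by rewrite /= !inE negb_or hk kk' eq_sym k'h.
move/card_uniqP => /= c3; have := two_ends (end_edge k).
suff : (3 <= #|[pred x | end_edge x == end_edge k]|)%N by move=> + e; rewrite e.
rewrite -c3; apply: subset_leq_card; apply/fintype.subsetP => x.
by rewrite !inE => /or3P[] /eqP ->; rewrite ?ehk ?ekk' eqxx.
Qed.

Hypothesis reg : three_regular G.

Lemma card_porbit_end (h : edge_end G) : #|porbit o h| = 3%N.
Proof.
rewrite -(reg (end_vertex h)); apply: fintype.eq_card => k.
by rewrite next_endP inE.
Qed.

Lemma same_vertex (h k : edge_end G) : end_vertex h = end_vertex k ->
  exists n, k = iter n o h.
Proof.
move=> e; have : k \in porbit o h by rewrite next_endP e.
by case/porbitP => n ->; exists n; rewrite permX.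
Qed.

(** Places increase by 1 modulo 3 along orbits of length 3. *)
Lemma place_inj (h k : edge_end G) : end_vertex h = end_vertex k ->
  p h = p k -> h = k.
Proof.
move=> /same_vertex [n ->].
have pE m : p (iter m o h) = ((p h + m) %% 3)%N :> nat.
  elim: m => [|m IH]; first by rewrite addn0 modn_small.
  by rewrite iterS placeP /= IH -addn1 modnDml addn1 addnS.
move=> /(congr1 val)/= /eqP; rewrite pE -{1}(modn_small (ltn_ord (p h))).
rewrite -{1}[nat_of_ord (p h)]addn0 eqn_modDl mod0n eq_sym => /eqP n3.
rewrite (divn_eq n 3) n3 addn0; elim: (n %/ 3)%N => [//|m IH].
by rewrite mulSn iterD -IH -(card_porbit_end h) iter_porbit.
Qed.

End EdgeEnds.

Section Gluing.
Variables (R : realType) (G : graph) (o : orientation G) (p : placement o).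
Hypothesis reg : three_regular G.
Local Notation C := (plane R).
Local Notation om := (omega R).
Local Notation side0 := (@side R ord0).

(** The triangle at the vertex of h, turned so that the side of h is side 0. *)
Definition end_point (h : edge_end G) (u : C) : SO R p :=
  SO_point R p (end_vertex h) (om ^+ p h * u).

Lemma side0_conj (u : C) : side0 u -> side0 (u^*)%C.
Proof. by move=> u0; rewrite -half_turn_side//; exact: half_turn_side0. Qed.

Lemma side_side0 (i : 'I_3) (u : C) : side i (om ^+ i * u) <-> side0 u.
Proof. by rewrite sideE side0E. Qed.

(** The equivalence relation generated by the gluing, in closed form; the point
    u is the one of side 0 corresponding to z once the side of h is brought
    there. *)
Inductive same_point (v w : vertex G) (z z' : C) : Prop :=
| SameTriangle of v = w & z = z'
| AcrossEdge h k u of h != k & end_edge h = end_edge k & end_vertex h = v &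
    end_vertex k = w & side0 u & om ^+ p h * u = z & om ^+ p k * (u^*)%C = z'.

Lemma same_point_sym v w z z' : same_point v w z z' -> same_point w v z' z.
Proof.
case=> [-> ->|h k u hk e hv kw s uz uz']; first exact: SameTriangle.
apply: (@AcrossEdge w v z' z k h (u^*)%C) => //; rewrite 1?eq_sym ?conjcK//.
exact: side0_conj.
Qed.

(** A second crossing starts at the side where the first one ends, because sides
    are disjoint; it is then along the same edge, from the end k, and so it must
    return to the end h. *)
Lemma same_point_trans v w x z z' z'' :
  same_point v w z z' -> same_point w x z' z'' -> same_point v x z z''.
Proof.
case=> [-> ->//|h k u hk e hv kw s uz uz'].
case=> [<- <-|h' k' u' hk' e' hv' kw' s' uw uw'].
  exact: AcrossEdge uz uz'.
have [pk uu'] : p k = p h' /\ (u^*)%C = u'.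
  apply: cell_rot_inj; [exact/side0_cell/side0_conj|exact: side0_cell|].
  by rewrite uz'.
have ? : k = h' by apply: (place_inj reg) pk; rewrite kw hv'.
subst h'; have ? := other_end hk e hk' e'; subst k'.
by apply: SameTriangle; rewrite -?hv// -uz -uw' -uu' conjcK.
Qed.

Lemma gluedP (x y : triangles R G) : glued p x y ->
  same_point (tag x) (tag y) (val (tagged x)) (val (tagged y)).
Proof.
move/asboolP; elim=> {x y}.
- move=> x y [h [k [s [hk e /side_gluingP gl [tx ty] [sx ->]]]]].
  have [a [b zE]] := rot_surj (p h) (val (tagged x)).
  rewrite gl//; apply: (@AcrossEdge _ _ _ _ h k (a +i* b)%C) => //.
    by rewrite -(side_side0 (p h)) -zE.
  by rewrite zE [om ^+ p h * _]mulrC mulfK ?omX_neq0.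
- by move=> x; exact: SameTriangle.
- by move=> x y _; exact: same_point_sym.
- by move=> x y z _ xy _; exact: same_point_trans.
Qed.

Lemma SO_point_eq v w z z' : triangle z -> triangle z' ->
  SO_point R p v z = SO_point R p w z' -> same_point v w z z'.
Proof.
move=> tz tz' /eqquotP/gluedP /=.
by rewrite !insubdK //; apply/mem_set.
Qed.

Lemma side_triangle i (z : C) : side i z -> triangle z.
Proof.
have [x [y ->]] := rot_surj i z => /side_side0/side0_cell[t _].
exact/triangle_rotX.
Qed.

Lemma end_point_across (h k : edge_end G) (u : C) : h != k ->
  end_edge h = end_edge k -> side0 u ->
  end_point h u = end_point k (half_turn u).
Proof.
move=> hk e su; rewrite half_turn_side//.
apply/eqquotP/asboolP/rst_step; exists h, k.
exists (fun z => om ^+ p k * ((z / om ^+ p h)^*)%C); rewrite /=.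
have sh : side (p h) (om ^+ p h * u) by apply/side_side0.
have sk : side (p k) (om ^+ p k * (u^*)%C) by apply/side_side0/side0_conj.
rewrite !insubdK; last 2 first.
- exact/mem_set/(side_triangle sk).
- exact/mem_set/(side_triangle sh).
split=> //; first exact/side_gluingP.
by split=> //; rewrite [om ^+ p h * _]mulrC mulfK ?omX_neq0.
Qed.

(** Crossing an edge happens on a side, and by [cell_rot_inj] the cell of h
    meets no other side than that of h. *)
Lemma end_point_eq (h k : edge_end G) (u w : C) : cell u -> cell w ->
  end_point h u = end_point k w ->
  (h = k /\ u = w) \/
  [/\ h != k, end_edge h = end_edge k, side0 u & w = half_turn u].
Proof.
move=> cu cw /SO_point_eq; case.
- by apply/triangle_rotX; case: cu.
- by apply/triangle_rotX; case: cw.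
- move=> hk /(cell_rot_inj cu cw) [pp ->]; left; split=> //.
  exact: place_inj pp.
move=> h' k' u' hk e vh vk s.
move=> /(cell_rot_inj (side0_cell s) cu) [ph <-].
move=> /(cell_rot_inj (side0_cell (side0_conj s)) cw) [pk <-].
by right; rewrite -(place_inj reg vh ph) -(place_inj reg vk pk) half_turn_side.
Qed.

End Gluing.

(** * Compatibility of the charts *)

Section LocalLifts.
Variables (R : realType) (X : topologicalType).
Local Notation C := (plane R).

(** Near z, the map f is a holomorphic map into the plane followed by the
    parametrization of d.  Such a lift, unlike the coordinate of d, can be
    exhibited and composed without knowing that the parametrization is
    injective. *)
Definition lifts (f : C -> X) (d : chart R X) (z : C) := exists m : C -> C,
  differentiable m z /\
  \forall u \near z, chart_dom d (m u) /\ chart_param d (m u) = f u.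

Lemma lifts_derivable f d z : {in chart_dom d &, injective (chart_param d)} ->
  lifts f d z -> derivable (chart_coord d \o f : C -> C) z 1.
Proof.
move=> inj [m [dm nm]].
apply: (@near_eq_derivable _ C C m); last exact/derivable1_diffP.
near=> u; have [du mu] : chart_dom d (m u) /\ chart_param d (m u) = f u.
  by near: u.
by rewrite /= -mu /chart_coord pinvKV//; exact/mem_set.
Unshelve. all: by end_near. Qed.

Lemma lifts_comp f d e z (m : C -> C) : differentiable m z ->
  (\forall u \near z, chart_param d (m u) = f u) ->
  lifts (chart_param d) e (m z) -> lifts f e z.
Proof.
move=> dm nm [m' [dm' nm']]; exists (m' \o m); split.
  exact: differentiable_comp.
have nm'' := differentiable_continuous dm nm'.
near=> u; have <- : chart_param d (m u) = f u by near: u.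
by near: u; exact: nm''.
Unshelve. all: by end_near. Qed.

Lemma lifts_self (d : chart R X) z : (\forall u \near z, chart_dom d u) ->
  lifts (chart_param d) d z.
Proof.
move=> nd; exists id; split; first exact/derivable1_diffP/derivable_id.
by near=> u; split => //; near: u.
Unshelve. all: by end_near. Qed.

Lemma mulr_differentiable (a z : C) : differentiable ( *%R a : C -> C) z.
Proof. by apply/derivable1_diffP; exact: derivableM. Qed.

End LocalLifts.

Section Atlas.
Variables (R : realType) (G : graph) (o : orientation G) (p : placement o).
Hypothesis reg : three_regular G.
Local Notation C := (plane R).
Local Notation om := (omega R).
Local Notation edge_map h k := (chart_param (edge_chart R p h k)).

Definition interior_triangle : set C :=
  [set z | `|z| < 1 /\ forall i : 'I_3, sqrtC 3 < `|z + 2 * om ^+ i|].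

Lemma interior_triangle_sub z : interior_triangle z -> triangle z.
Proof. by case=> z1 zi; split=> // i; exact/ltW/zi. Qed.

Lemma interior_not_side i z : interior_triangle z -> ~ side i z.
Proof. by move=> [_ zi] [_ e]; have := zi i; rewrite e ltxx. Qed.

Lemma interior_triangle_open z : interior_triangle z ->
  \forall u \near z, interior_triangle u.
Proof.
move=> [z1 zi]; have W (i : 'I_3) :
    \forall u \near z, sqrtC 3 < `|u + 2 * om ^+ i|.
  exact: outside_open.
have W0 := W 0; have W1 := W 1; have W2 := W (1 + 1).
near=> u; split; first by near: u; exact: disk_open.
move=> i; have [->|/ord3E [] ->] := eqVneq i ord0; near: u.
- exact: W0.
- exact: W1.
- exact: W2.
Unshelve. all: by end_near. Qed.

Lemma interior_cell i u : cell u -> sqrtC 3 < `|u + 2| ->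
  interior_triangle (om ^+ (i : 'I_3) * u).
Proof.
move=> [[u1 _] V] u3; split; first by rewrite norm_rot.
move=> j; have [k ->] : exists k, j = i + k.
  by exists (j - i); rewrite addrC subrK.
rewrite norm_vertex_rot; have [->|/V] := eqVneq k ord0.
  by rewrite expr0 mulr1.
exact: lt_trans.
Qed.

Lemma interior_triangle_out i u : interior_triangle (om ^+ (i : 'I_3) * u) ->
  sqrtC 3 < `|u + 2|.
Proof.
case=> _ /(_ i); have := norm_vertex_rot i 0 u; rewrite addr0 mulr1.
by move=> ->.
Qed.

Lemma interior_same_point v w z z' : interior_triangle z ->
  same_point p v w z z' -> v = w /\ z = z'.
Proof.
move=> zi [//|h k u _ _ _ _ su uz]; case: (interior_not_side (i := p h) zi).
by rewrite -uz; apply/side_side0.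
Qed.

Lemma edge_map_out h k z : sqrtC 3 <= `|z + 2| ->
  edge_map h k z = end_point p h z.
Proof. by move=> /= ->. Qed.

Section Edge.
Variables (h k : edge_end G) (hk : h != k) (ehk : end_edge h = end_edge k).

(** Off side 0 the two charts use the same triangle.  On side 0 the test in the
    chart of an edge selects its first end for z as well as for half_turn z, and
    the equality is the gluing itself. *)
Lemma edge_map_flip z : `|z| < 1 -> edge_map h k z = edge_map k h (half_turn z).
Proof.
move=> z1; have hz1 := half_turn_disk z1; case: (sqrt3_cases z) => z3.
- rewrite edge_map_out ?ltW//= half_turn_ler//.
  by rewrite (lt_geF z3) half_turnK.
- rewrite (@edge_map_out k) ?half_turn_ler ?ltW//.
  by rewrite /= (lt_geF z3).
- rewrite (@edge_map_out k) ?half_turn_ler ?z3//.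
  rewrite edge_map_out ?z3//; apply: end_point_across => //.
  by rewrite side0E.
Qed.

Lemma lifts_edge_self z : edge_domain z ->
  lifts (edge_map h k) (edge_chart R p h k) z.
Proof. by move=> dz; apply: lifts_self; exact: edge_domain_open. Qed.

Lemma lifts_edge_flip d z : edge_domain z ->
  lifts (edge_map k h) d (half_turn z) -> lifts (edge_map h k) d z.
Proof.
move=> dz; have z1 : `|z| < 1 by case: dz.
apply: (@lifts_comp _ _ _ (edge_chart R p k h) d z (@half_turn R)).
  exact: half_turn_differentiable.
by apply: filterS (disk_open z1) => u u1; rewrite (edge_map_flip u1).
Qed.

Lemma lifts_vertex_edge z : cell z -> sqrtC 3 < `|z + 2| ->
  lifts (SO_point R p (end_vertex h)) (edge_chart R p h k) (om ^+ p h * z).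
Proof.
move=> cz z3.
have rK u : om ^+ (- p h)%R * (om ^+ p h * u) = u.
  by rewrite mulrA -omegaD addNr mul1r.
have rK' u : om ^+ p h * (om ^+ (- p h)%R * u) = u.
  by rewrite mulrA -omegaD addrN mul1r.
exists (fun u => om ^+ (- p h)%R * u); split; first exact: mulr_differentiable.
have := @mulr_differentiable R (om ^+ (- p h)%R) (om ^+ p h * z).
move=> /differentiable_continuous cr.
have dz : edge_domain z by case/cellE: (cz) => z1 _ _; split=> //; left.
have n1 := outside_open z3; have n2 := edge_domain_open dz.
rewrite -(rK z) in n1 n2.
have {}n1 := cr _ n1; have {}n2 := cr _ n2.
near=> u; split; first by near: u; exact: n2.
rewrite edge_map_out; first by rewrite /end_point rK'.
by apply: ltW; near: u; exact: n1.
Unshelve. all: by end_near. Qed.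

Lemma lifts_edge_vertex z : edge_domain z -> sqrtC 3 < `|z + 2| ->
  lifts (edge_map h k) (vertex_chart R p (end_vertex h)) z.
Proof.
move=> dz z3; exists (fun u => om ^+ p h * u); split.
  exact: mulr_differentiable.
have n1 := outside_open z3; have n2 := edge_domain_open dz.
near=> u; have u3 : sqrtC 3 < `|u + 2| by near: u; exact: n1.
have du : edge_domain u by near: u; exact: n2.
split; last by rewrite edge_map_out// ltW.
by apply: interior_cell => //; apply: edge_domain_out => //; exact: ltW.
Unshelve. all: by end_near. Qed.

End Edge.

Lemma lifts_to_flip f h k z : h != k -> end_edge h = end_edge k ->
  lifts f (edge_chart R p k h) z -> lifts f (edge_chart R p h k) z.
Proof.
move=> hk e [m [dm nm]].
apply: (@lifts_comp _ _ _ (edge_chart R p k h) _ _ m) => //.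
  by apply: filterS nm => u [].
have [dmz _] := nbhs_singleton nm.
apply: lifts_edge_flip => //; first by rewrite eq_sym.
exact/lifts_edge_self/edge_domain_half_turn.
Qed.

(** Every point of an edge chart lies in the cell of one of its two ends; this
    reduces all comparisons of charts to cells. *)
Lemma edge_mapP h k z : edge_domain z ->
  (cell z /\ edge_map h k z = end_point p h z) \/
  (cell (half_turn z) /\ edge_map h k z = end_point p k (half_turn z)).
Proof.
move=> dz; case: (sqrt3_cases z) => z3.
- left; split; first by apply: edge_domain_out => //; exact: ltW.
  by apply: edge_map_out; exact: ltW.
- right; split; first by apply: edge_domain_in => //; exact: ltW.
  by rewrite /= (lt_geF z3).
- left; split; first by apply: edge_domain_out; rewrite ?z3.
  by apply: edge_map_out; rewrite z3.
Qed.

Lemma edge_map_inj h k : h != k ->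
  {in @edge_domain R &, injective (edge_map h k)}.
Proof.
move=> hk z w /set_mem dz /set_mem dw; have z1 : `|z| < 1 by case: dz.
have w1 : `|w| < 1 by case: dw.
have ht_inj : half_turn z = half_turn w -> z = w.
  by move=> e; rewrite -(half_turnK z1) e half_turnK.
have nhk (q : edge_end G) : q != q -> False by rewrite eqxx.
case: (edge_mapP h k dz) => -[cz ->]; case: (edge_mapP h k dw) => -[cw ->].
- by move=> /(end_point_eq reg cz cw)[[]//|[/nhk]].
- move=> /(end_point_eq reg cz cw)[[hk']|[_ _ _ /esym//]].
  by move: hk; rewrite hk' => /nhk.
- move=> /esym/(end_point_eq reg cw cz)[[hk']|[_ _ _ //]].
  by move: hk; rewrite hk' => /nhk.
- by move=> /(end_point_eq reg cz cw)[[]//|[/nhk]].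
Qed.

Lemma vertex_map_inj v : {in interior_triangle &, injective (SO_point R p v)}.
Proof.
move=> z w /set_mem zi /set_mem wi /(SO_point_eq reg) -/(_ _ _)H.
by case: (interior_same_point zi (H _ _)) => //; exact: interior_triangle_sub.
Qed.

Lemma chart_inj (c : chart R (SO R p)) : SO_atlas R p c ->
  {in chart_dom c &, injective (chart_param c)}.
Proof.
case=> [[v ->]|[h [k [hk _ ->]]]]; first exact: vertex_map_inj.
exact: edge_map_inj.
Qed.

(** Flipping the charts moves both points to cells.  Equal points of two cells
    then belong to the same end, with the identity as transition map, or to the
    two ends of one edge, with the half-turn. *)
Lemma lifts_edge_edge h k h' k' z w :
  h != k -> end_edge h = end_edge k -> h' != k' -> end_edge h' = end_edge k' ->
  edge_domain z -> edge_domain w -> edge_map h k z = edge_map h' k' w ->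
  lifts (edge_map h k) (edge_chart R p h' k') z.
Proof.
have core a b a' b' x y : a != b -> end_edge a = end_edge b ->
    a' != b' -> end_edge a' = end_edge b' -> edge_domain x ->
    cell x -> cell y -> end_point p a x = end_point p a' y ->
    lifts (edge_map a b) (edge_chart R p a' b') x.
  move=> ab eab ab' eab' dx cx cy /(end_point_eq reg cx cy)[[? _]|[aa eaa _ _]].
    subst a'; have -> : b' = b.
      by apply: (@other_end G b a b') => //; rewrite eq_sym.
    exact: lifts_edge_self.
  have ? : a' = b by apply: (@other_end G b a a') => //; rewrite eq_sym.
  subst a'; have -> : b' = a by apply: (@other_end G a b b').
  by apply: lifts_edge_flip => //; exact/lifts_edge_self/edge_domain_half_turn.
move=> hk e hk' e' dz dw.
have kh : k != h by rewrite eq_sym.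
have kh' : k' != h' by rewrite eq_sym.
have dhz := edge_domain_half_turn dz; have dhw := edge_domain_half_turn dw.
case: (edge_mapP h k dz) => -[cz ->]; case: (edge_mapP h' k' dw) => -[cw ->] E.
- exact: core cz cw E.
- by apply: lifts_to_flip => //; exact: core cz cw E.
- by apply: lifts_edge_flip => //; exact: core cz cw E.
- apply: lifts_to_flip => //; apply: lifts_edge_flip => //.
  exact: core cz cw E.
Qed.

Lemma lifts_vertex_edgeP v h k z w : h != k -> end_edge h = end_edge k ->
  interior_triangle z -> edge_domain w -> SO_point R p v z = edge_map h k w ->
  lifts (SO_point R p v) (edge_chart R p h k) z.
Proof.
have core a b y : a != b -> end_edge a = end_edge b -> interior_triangle z ->
    cell y -> SO_point R p v z = end_point p a y ->
    lifts (SO_point R p v) (edge_chart R p a b) z.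
  move=> ab e zi cy /(SO_point_eq reg)[].
  - exact: interior_triangle_sub.
  - by apply/triangle_rotX; case: cy.
  - move=> -> zy; rewrite zy in zi *; apply: lifts_vertex_edge => //.
    exact: interior_triangle_out zi.
  by move=> a' b' u _ _ _ _ su uz; case: (@interior_not_side (p a') _ zi);
    rewrite -uz; apply/side_side0.
move=> hk e zi dw; case: (edge_mapP h k dw) => -[cw ->] E.
  exact: core cw E.
apply: lifts_to_flip => //; apply: core cw E => //.
by rewrite eq_sym.
Qed.

Lemma lifts_edge_vertexP v h k z w : h != k -> end_edge h = end_edge k ->
  interior_triangle z -> edge_domain w -> SO_point R p v z = edge_map h k w ->
  lifts (edge_map h k) (vertex_chart R p v) w.
Proof.
have core a b y : interior_triangle z -> edge_domain y ->
    cell y -> SO_point R p v z = end_point p a y ->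
    lifts (edge_map a b) (vertex_chart R p v) y.
  move=> zi dy cy E.
  have ty : triangle (om ^+ p a * y) by apply/triangle_rotX; case: cy.
  have sp := SO_point_eq reg (interior_triangle_sub zi) ty E.
  have [-> zy] := interior_same_point zi sp.
  apply: lifts_edge_vertex => //; apply: (@interior_triangle_out (p a)).
  by rewrite -zy.
move=> hk e zi dw; case: (edge_mapP h k dw) => -[cw ->] E.
  exact: core cw E.
apply: lifts_edge_flip => //; apply: core cw E => //.
exact: edge_domain_half_turn.
Qed.

Lemma SO_atlas_compatible (c d : chart R (SO R p)) z w :
  SO_atlas R p c -> SO_atlas R p d -> chart_dom c z -> chart_dom d w ->
  chart_param c z = chart_param d w -> lifts (chart_param c) d z.
Proof.
case=> [[v ->]|[h [k [hk e ->]]]]; case=> [[v' ->]|[h' [k' [hk' e' ->]]]].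
- move=> zi wi /(SO_point_eq reg) H.
  case: (interior_same_point zi (H _ _)).
  + exact: interior_triangle_sub.
  + exact: interior_triangle_sub.
  by move=> -> _; apply: lifts_self; exact: interior_triangle_open.
- exact: lifts_vertex_edgeP.
- by move=> dz wi /esym; exact: lifts_edge_vertexP.
- exact: lifts_edge_edge.
Qed.

End Atlas.

(** * The induced map *)

Section InducedMap.
Variables (R : realType) (G : graph) (o : orientation G) (p : placement o).
Variable phi : graph_automorphism G.
Hypothesis reg : three_regular G.
Hypothesis phi_or : orientation_preserving o phi.
Local Notation C := (plane R).
Local Notation om := (omega R).
Local Notation side0 := (@side R ord0).

Definition end_twist (h : edge_end G) : 'I_3 := p (aut_end phi h) - p h.

(** By [end_twist_vertex] the end picked does not matter. *)
Definition twist (v : vertex G) : 'I_3 :=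
  if [pick h | end_vertex h == v] is Some h then end_twist h else 0.

Lemma ordSE (i : 'I_3) : ordS i = i + 1.
Proof. by apply: val_inj; rewrite /= addn1. Qed.

Lemma end_twist_vertex h k : end_vertex h = end_vertex k ->
  end_twist h = end_twist k.
Proof.
move=> /(same_vertex o) [n ->]; elim: n => [//|n ->]; rewrite iterS.
by rewrite /end_twist phi_or !placeP !ordSE opprD addrACA subrr addr0.
Qed.

Lemma twistE h : twist (end_vertex h) = end_twist h.
Proof.
rewrite /twist; case: pickP => [k /eqP/end_twist_vertex//|/(_ h)].
by rewrite eqxx.
Qed.

Lemma twist_place h (u : C) :
  om ^+ twist (end_vertex h) * (om ^+ p h * u) = om ^+ p (aut_end phi h) * u.
Proof. by rewrite mulrA -omegaD twistE subrK. Qed.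

Definition rotate (i : 'I_3) (x : set_type (@triangle R)) :
    set_type (@triangle R) :=
  exist _ (om ^+ i * val x)
    (mem_set (triangle_rot i (set_mem (valP x)))).

Definition rotate_triangles (x : triangles R G) : triangles R G :=
  existT _ (aut_vertex phi (tag x)) (rotate (twist (tag x)) (tagged x)).

Definition induced_map (x : SO R p) : SO R p :=
  \pi_{eq_quot (glued_equiv R p)}%qT (rotate_triangles (repr x)).

Lemma same_point_SO v w z z' : same_point p v w z z' ->
  SO_point R p v z = SO_point R p w z'.
Proof.
case=> [-> -> //|h k u hk e <- <- su <- <-].
by have := end_point_across p hk e su; rewrite half_turn_side.
Qed.

Lemma SO_pointE (v : vertex G) (x : set_type (@triangle R)) :
  SO_point R p v (val x) = \pi_{eq_quot (glued_equiv R p)}%qT (existT _ v x).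
Proof. by rewrite /SO_point valKd. Qed.

Lemma same_point_image v w z z' : same_point p v w z z' ->
  same_point p (aut_vertex phi v) (aut_vertex phi w)
    (om ^+ twist v * z) (om ^+ twist w * z').
Proof.
case=> [-> ->|h k u hk e <- <- su <- <-]; first exact: SameTriangle.
rewrite !twist_place; apply: (@AcrossEdge _ _ _ _ _ _ _ _
  (aut_end phi h) (aut_end phi k) u) => //.
- by rewrite (inj_eq perm_inj).
- by rewrite !aut_end_edge e.
- by rewrite aut_end_vertex.
- by rewrite aut_end_vertex.
Qed.

Lemma induced_map_pi (x : triangles R G) :
  induced_map (\pi_{eq_quot (glued_equiv R p)}%qT x) =
  \pi_{eq_quot (glued_equiv R p)}%qT (rotate_triangles x).
Proof.
rewrite /induced_map; set y := repr _.
have : same_point p (tag y) (tag x) (val (tagged y)) (val (tagged x)).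
  by apply: gluedP => //; apply/eqquotP; exact: reprK.
by move=> /same_point_image/same_point_SO; rewrite !(SO_pointE _ (rotate _ _)).
Qed.

Lemma induced_map_point v z : triangle z ->
  induced_map (SO_point R p v z) =
  SO_point R p (aut_vertex phi v) (om ^+ twist v * z).
Proof.
move=> /mem_set tz.
have -> : z = val (exist _ z tz : set_type (@triangle R)) by [].
by rewrite SO_pointE induced_map_pi -SO_pointE.
Qed.

Lemma induced_map_end h u : cell u ->
  induced_map (end_point p h u) = end_point p (aut_end phi h) u.
Proof.
move=> [tu _]; rewrite /end_point induced_map_point; last exact/triangle_rotX.
by rewrite twist_place aut_end_vertex.
Qed.

Lemma SO_pointP (x : SO R p) : exists v z, triangle z /\ x = SO_point R p v z.
Proof.
have : \pi_{eq_quot (glued_equiv R p)}%qT (repr x) = x := reprK x.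
case: (repr x) => v y <-; exists v, (val y); rewrite SO_pointE.
by split=> //; exact: set_mem (valP y).
Qed.

Lemma rotate_continuous i : continuous (rotate i).
Proof.
apply: continuous_comp_initial => x.
have H : {for x, continuous (( *%R (om ^+ i) : C -> C) \o
    (set_val : set_type (@triangle R) -> C))}.
  apply: continuous_comp; first exact: initial_continuous.
  by apply: differentiable_continuous; exact: mulr_differentiable.
exact: H.
Qed.

Lemma induced_map_continuous : continuous induced_map.
Proof.
apply/quotient_continuous.
have -> : induced_map \o \pi_{eq_quot (glued_equiv R p)}%qT =
    fun x => \pi_{eq_quot (glued_equiv R p)}%qT (rotate_triangles x).
  by apply/funext => x; exact: induced_map_pi.
have cv v : continuous ((fun x => \pi_{eq_quot (glued_equiv R p)}%qT
    (existT _ (aut_vertex phi v) (rotate (twist v) x) : triangles R G))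
    : set_type (@triangle R) -> SO R p).
  move=> x; apply: continuous_comp; last exact: pi_continuous.
  apply: continuous_comp; first exact: rotate_continuous.
  exact: existT_continuous.
apply/continuousP => A oA; apply/sigT_openP => v.
by move/continuousP: (cv v); apply.
Qed.

(** The twist appears as a rotation between the charts of v and phi v; between
    the charts of an edge and of its image it is absorbed by the places. *)
Lemma induced_map_chart (c : chart R (SO R p)) z : SO_atlas R p c ->
  chart_dom c z -> exists c' (m : C -> C), [/\ SO_atlas R p c',
    differentiable m z, chart_dom c' (m z) &
    \forall u \near z, chart_param c' (m u) = induced_map (chart_param c u)].
Proof.
case=> [[v ->]|[h [k [hk e ->]]]] dz.
  exists (vertex_chart R p (aut_vertex phi v)), (fun u => om ^+ twist v * u).
  split; [by left; eexists|exact: mulr_differentiable| |].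
    case: dz => z1 zi; split; first by rewrite norm_rot.
    move=> j; have [i ->] : exists i, j = twist v + i.
      by exists (j - twist v); rewrite addrC subrK.
    by rewrite norm_vertex_rot.
  apply: filterS (interior_triangle_open dz) => u ui.
  by rewrite /= induced_map_point//; exact: interior_triangle_sub.
exists (edge_chart R p (aut_end phi h) (aut_end phi k)), id.
split; [|exact/derivable1_diffP/derivable_id|exact: dz|].
  right; exists (aut_end phi h), (aut_end phi k).
  by rewrite (inj_eq perm_inj) !aut_end_edge e.
apply: filterS (edge_domain_open dz) => u du.
rewrite /=; case: (sqrt3_cases u) => u3.
- rewrite ltW//; apply/esym/induced_map_end/edge_domain_out => //; exact: ltW.
- rewrite (lt_geF u3); apply/esym/induced_map_end/edge_domain_in => //.
  exact: ltW.
- by rewrite u3 lexx; apply/esym/induced_map_end/edge_domain_out; rewrite ?u3.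
Qed.

Lemma induced_map_holomorphic :
  holomorphic_map (SO_atlas R p) (SO_atlas R p) induced_map.
Proof.
split; first exact: induced_map_continuous.
move=> c d Ac Ad z dz [w dw wE].
apply: lifts_derivable; first exact: chart_inj.
have [c' [m [Ac' dm dmz nm]]] := induced_map_chart Ac dz.
apply: (lifts_comp dm nm); apply: (SO_atlas_compatible reg Ac' Ad dmz dw).
by rewrite wE (nbhs_singleton nm).
Qed.

Lemma induced_map_triangle v :
  induced_map @` SO_triangle R p v = SO_triangle R p (aut_vertex phi v).
Proof.
apply/seteqP; split=> [_ [_ [z tz <-] <-]|_ [z tz <-]].
  rewrite induced_map_point//; exists (om ^+ twist v * z) => //.
  exact: triangle_rot.
have tz' := triangle_rot (- twist v) tz.
exists (SO_point R p v (om ^+ (- twist v)%R * z)).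
  by exists (om ^+ (- twist v)%R * z).
by rewrite induced_map_point// mulrA -omegaD addrN mul1r.
Qed.

Lemma SO_side_end h : SO_side R p h = end_point p h @` side0.
Proof.
apply/seteqP; split=> [_ [z sz <-]|_ [u su <-]]; last first.
  by exists (om ^+ p h * u) => //; apply/side_side0.
have [x [y zE]] := rot_surj (p h) z; exists (x +i* y)%C.
  by rewrite -(side_side0 (p h)) -zE.
by rewrite /end_point -zE.
Qed.

Lemma induced_map_side h :
  induced_map @` SO_side R p h = SO_side R p (aut_end phi h).
Proof.
rewrite !SO_side_end; apply/seteqP; split=> [_ [_ [u su <-] <-]|_ [u su <-]].
  by rewrite induced_map_end; [exists u|exact: side0_cell].
exists (end_point p h u); first by exists u.
by rewrite induced_map_end//; exact: side0_cell.
Qed.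

End InducedMap.

Section Inverse.
Variables (G : graph) (o : orientation G) (p : placement o).

Definition inverse_automorphism (phi : graph_automorphism G) :
  graph_automorphism G.
Proof.
exists (aut_vertex phi)^-1%g (aut_edge phi)^-1%g (aut_end phi)^-1%g => h.
- by apply: (canRL (permK _)); rewrite -aut_end_vertex permKV.
- by apply: (canRL (permK _)); rewrite -aut_end_edge permKV.
Defined.

Lemma inverse_orientation_preserving phi : orientation_preserving o phi ->
  orientation_preserving o (inverse_automorphism phi).
Proof.
by move=> pr h; apply: (canLR (permK _)); rewrite pr permKV.
Qed.

Variables (R : realType) (phi psi : graph_automorphism G).
Hypothesis reg : three_regular G.
Hypothesis phi_or : orientation_preserving o phi.
Hypothesis psi_or : orientation_preserving o psi.
Hypothesis endK : cancel (aut_end phi) (aut_end psi).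
Hypothesis vertexK : cancel (aut_vertex phi) (aut_vertex psi).

(** The twists of phi at v and of psi at phi v are opposite, as is seen on any
    end at v. *)
Lemma induced_mapK :
  cancel (@induced_map R G o p phi) (@induced_map R G o p psi).
Proof.
move=> x; have [v [z [tz ->]]] := SO_pointP x.
rewrite !induced_map_point//; last exact: triangle_rot.
have /existsP[h /eqP <-] : [exists h : edge_end G, end_vertex h == v].
  apply/existsPn => nb; have := reg v; rewrite eq_card0 // => h.
  by rewrite !inE; exact/negbTE.
rewrite vertexK mulrA -omegaD -aut_end_vertex !twistE// /end_twist endK.
by rewrite addrA subrK subrr mul1r.
Qed.

End Inverse.

Theorem proposition1p7p5 (R : realType) (G : graph) (o : orientation G)
    (p : placement o) (phi : graph_automorphism G) :
  connected_graph G -> three_regular G -> orientation_preserving o phi ->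
  exists Phi : SO R p -> SO R p,
    [/\ riemann_surface_automorphism (SO_atlas R p) Phi,
        forall v : vertex G,
          Phi @` SO_triangle R p v = SO_triangle R p (aut_vertex phi v) &
        forall h : edge_end G,
          Phi @` SO_side R p h = SO_side R p (aut_end phi h)].
Proof.
move=> _ reg phi_or; have psi_or := inverse_orientation_preserving phi_or.
exists (induced_map phi); split=> [|v|h].
- exists (induced_map (inverse_automorphism phi)); split.
  + by apply: induced_mapK => //; exact: permK.
  + by apply: induced_mapK => //; exact: permKV.
  + exact: induced_map_holomorphic.
  + exact: induced_map_holomorphic.
- exact: induced_map_triangle.
- exact: induced_map_side.
Qed.
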